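(* Let $(\tau,X)$ be a pair of (generally correlated) real random variables with $\tau>0$ almost surely, and let $S(\cdot)$ be the associated renewal-reward process. Assume that $\mathbb{E}\tau<\infty$, that \[ \mathbb{E}\exp(\lambda X-\varepsilon\tau)<\infty\quad\text{for all }\lambda\in\mathbb{R}\text{ and all }\varepsilon>0, \] and that $\mathbb{E}X=0$. Then: (1) for every $\lambda\in\mathbb{R}$ there exists one and only one $\eta_\lambda\in[0,\infty)$ such that $\mathbb{E}\exp(\lambda X-\eta_\lambda\tau)=1$; (2) whenever $0<c<C<\infty$, \[ \frac1t\ln\mathbb{E}\exp\bigl(\lambda S(t)\bigr)=\eta_\lambda+O\Bigl(\frac1t\Bigr)\quad\text{as }t\to\infty, \] uniformly in $\lambda\in[-C,-c]\cup[c,C]$; that is, there exist $T,K\in(0,\infty)$ such that $\bigl|\frac1t\ln\mathbb{E}\exp(\lambda S(t))-\eta_\lambda\bigr|\le K/t$ for all $t\ge T$ and all $\lambda\in[-C,-c]\cup[c,C]$.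
   Context: Renewal-reward process: let $(\tau_1,X_1),(\tau_2,X_2),\dots$ be independent copies of the pair $(\tau,X)$. For $t\ge 0$, $S(t)=X_1+\dots+X_n$ whenever $\tau_1+\dots+\tau_n\le t<\tau_1+\dots+\tau_{n+1}$, $n=0,1,2,\dots$ (empty sums are $0$). This defines $S(t)$ for all $t\ge0$ almost surely. (The hypotheses imply $\mathbb{E}|X|<\infty$, so $\mathbb{E}X$ makes sense.) *)

(* Defs.v *)
From HB Require Import structures.
From mathcomp Require Import all_boot all_order all_algebra.
From mathcomp Require Import finmap.
From mathcomp Require Import all_classical all_reals all_analysis.

Set Implicit Arguments.
Unset Strict Implicit.
Unset Printing Implicit Defensive.

Import Order.TTheory GRing.Theory Num.Theory.
Import numFieldNormedType.Exports.

Local Open Scope classical_set_scope.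
Local Open Scope ring_scope.

(* The two variables may live on different probability spaces: a given space
   need not be rich enough to carry independent copies of its own variables. *)
Definition same_distribution (R : realType)
    (d d' d'' : measure_display) (T : measurableType d) (T' : measurableType d')
    (E : measurableType d'')
    (P : probability T R) (P' : probability T' R)
    (Y : T -> E) (Y' : T' -> E) : Prop :=
  forall A : set E, measurable A -> P (Y @^-1` A) = P' (Y' @^-1` A).

Definition mutually_independent (R : realType) (I : choiceType)
    (d d' : measure_display) (T : measurableType d) (E : measurableType d')
    (P : probability T R) (Y : I -> T -> E) : Prop :=
  forall (J : {fset I}) (A : I -> set E),
    (forall i, measurable (A i)) ->
    P (\bigcap_(i in [set` J]) (Y i @^-1` A i)) =
    (\prod_(i <- J) P (Y i @^-1` A i))%E.

Section renewal_reward.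
Variables (R : realType) (T : Type).

(* Sequences are indexed from 0: tau i and X i stand for tau_{i+1}, X_{i+1}. *)
Definition renewal_time (tau : nat -> T -> R) (n : nat) (w : T) : R :=
  \sum_(i < n) tau i w.

Definition renewal_index (tau : nat -> T -> R) (t : R) (w : T) : pred nat :=
  fun n => renewal_time tau n w <= t < renewal_time tau n.+1 w.

(* When all tau i w are positive there is at most one renewal index (see
   renewal_rewardE); taking the least one, and 0 if there is none, only
   matters on a null set. *)
Definition renewal_reward (tau X : nat -> T -> R) (t : R) (w : T) : R :=
  match pselect (exists n, renewal_index tau t w n) with
  | left h => \sum_(i < ex_minn h) X i w
  | right _ => 0
  end.

Lemma renewal_index_inj (tau : nat -> T -> R) (t : R) (w : T) (m n : nat) :
  (forall i, 0 < tau i w) ->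
  renewal_index tau t w m -> renewal_index tau t w n -> m = n.
Proof.
move=> tau_gt0.
have mono k l : (k <= l)%N -> renewal_time tau k w <= renewal_time tau l w.
  elim: l => [|l IH]; first by rewrite leqn0 => /eqP ->.
  rewrite leq_eqVlt => /orP[/eqP -> //|]; rewrite ltnS => /IH kl.
  apply: (le_trans kl); rewrite /renewal_time big_ord_recr /= lerDl.
  exact: ltW.
move=> /andP[m1 m2] /andP[n1 n2]; case: (ltngtP m n) => // /mono h.
- by have := lt_le_trans m2 (le_trans h n1); rewrite ltxx.
- by have := lt_le_trans n2 (le_trans h m1); rewrite ltxx.
Qed.

Lemma renewal_rewardE (tau X : nat -> T -> R) (t : R) (w : T) (n : nat) :
  (forall i, 0 < tau i w) ->
  renewal_time tau n w <= t < renewal_time tau n.+1 w ->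
  renewal_reward tau X t w = \sum_(i < n) X i w.
Proof.
move=> tau_gt0 hn; rewrite /renewal_reward; case: pselect => [h|]; last first.
  by case; exists n.
by case: ex_minnP => m hm _; rewrite (renewal_index_inj tau_gt0 hm hn).
Qed.

End renewal_reward.

(* Main.v *)
Require Import Defs.
From HB Require Import structures.
From mathcomp Require Import all_boot all_order all_algebra.
From mathcomp Require Import finmap.
From mathcomp Require Import all_classical all_reals all_analysis.
From mathcomp Require Import measurable_realfun ring lra.

Set Implicit Arguments.
Unset Strict Implicit.
Unset Printing Implicit Defensive.

Import Order.TTheory GRing.Theory Num.Theory.
Import numFieldNormedType.Exports.

Local Open Scope classical_set_scope.
Local Open Scope ring_scope.

(** The existence and uniqueness of [eta] come from the shape of the Laplace
    transform [laplace l e], the expectation of [exp (l X - e tau)].  It is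
    strictly decreasing in [e] as [tau > 0], it is finite and continuous for
    [e > 0], it tends to [0] as [e] grows, and at [e = 0] it is at least [1]
    because [1 + l X <= exp (l X)] and [X] is centred.  Hence it takes the
    value [1] exactly once.

    For the growth rate, fix [l], put [e = eta l] and write [T_n], [S_n] for the
    renewal times and the accumulated rewards.  The process
    [M_n = exp (l S_n - e T_n)] is a martingale of mean [1]; using it as a
    density turns the times [T_n] into a renewal process with another step law,
    and
      [E exp (l S(t) - e t)] = sum over [n] of
      [E (exp (l S_n - e t); T_n <= t < T_(n+1))].
    It is enough to enclose this quantity between two positive constants that
    depend neither on [t] nor on [l] in the given range, since taking logarithms
    and dividing by [t] then gives the claim ([log_growth_rate]).

    The single analytic tool is the linear bound [renewal_potential] on the
    number of renewals in a window.  A Lyapunov function that decreases by at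
    least [min (tau, 1)] at each step issued from the window, and never
    increases, bounds the tilted expected number of visits to the window by its
    initial value divided by the tilted mean [delta] of [min (tau, 1)].
    Windows of length [s] thus receive at most [(1 + s) / delta] visits
    ([window_potential]).  Integrated against the next step, this bounds sums
    over the step that crosses the level [t] ([crossing_upper]).

    Upper bound: on the crossing event [exp (l S_n - e t) <= M_n].

    Lower bound: under the tilted law the level [t] is crossed almost surely, so
    the terms [E (M_(n+1); T_n <= t < T_(n+1))] add up to [1],
    and finitely many of them to at least [1/2] ([crossing_lower]).
    The one-step factor [M_(n+1) / M_n] is at most
    [k exp (- e (t - T_n))] as long as [exp (l X) <= k]; the steps where
    [exp (l X) > k] contribute at most [1/k] times a quantity controlled by
    [crossing_upper] and the mean of [(1 + tau) exp (2 l X - e tau)].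
    A large [k] leaves at least [1/4] for the good steps
    ([crossing_value_lower]).

    Uniformity in [l] rests on convexity: [eta] is monotone on each half-line
    ([eta_scale]), hence bounded above and below on the range considered.  The
    upper bound makes [delta] bounded below ([drift_lower_bound]).  The lower
    bound is positive unless [X] vanishes almost surely, and in both cases the
    mean of [(1 + tau) exp (2 l X - e tau)] stays bounded
    ([tilted_overshoot_bound]). *)

(** * Product laws from independence *)

Section independence.
Context (R : realType) (d d0 d1 d2 : measure_display).
Context (T : measurableType d) (T0 : measurableType d0).
Context (E1 : measurableType d1) (E2 : measurableType d2).
Context (P : probability T R) (P0 : probability T0 R).
Local Open Scope ereal_scope.

(** The event [C] stands for what happens strictly later: carrying it along is
    what lets the independence of a recursively defined state from the future
    pass from one step to the next. *)
Lemma joint_law_prod (Z : {mfun T >-> E1}) (Y : {mfun T >-> E2}) (C : set T) :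
  measurable C ->
  (forall A B, measurable A -> measurable B ->
     P (Z @^-1` A `&` Y @^-1` B `&` C) =
     P (Z @^-1` A) * P (Y @^-1` B) * P C) ->
  forall W, measurable W ->
    P ((fun w => (Z w, Y w)) @^-1` W `&` C) =
    (distribution P Z \x distribution P Y) W * P C.
Proof.
move=> mC ZYC W mW.
have c0 : (0 <= fine (P C))%R by exact: fine_ge0.
have PCE : P C = (fine (P C))%:E by rewrite fineK// fin_num_measure.
(* the factor [P C] is absorbed into one marginal, so that both sides become
   honest measures agreeing on rectangles *)
pose m1 := mscale (NngNum c0) (distribution P Z).
have mZY : measurable_fun setT (fun w => (Z w, Y w)).
  exact: measurable_fun_pair.
pose ZY : {mfun T >-> (E1 * E2)%type} :=
  HB.pack (fun w => (Z w, Y w)) (isMeasurableFun.Build _ _ _ _ _ mZY).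
have H := @product_measure_unique _ _ _ _ _ m1 (distribution P Y)
  (pushforward (mrestr P mC) ZY).
rewrite -[LHS]/(pushforward (mrestr P mC) ZY W) -H//.
  rewrite /product_measure1/=.
  rewrite ge0_integral_mscale//=; last first.
    exact: measurable_fun_xsection.
  by rewrite muleC -PCE.
move=> A B mA mB.
rewrite /pushforward /mrestr/= /m1/mscale/= -PCE.
rewrite (_ : P C * _ * _ = P (Z @^-1` A) * P (Y @^-1` B) * P C).
  by rewrite -ZYC.
by rewrite muleC [P C * _]muleC muleA [X in X * P C]muleC.
Qed.

(** The outer integral is over the independent copy [Y0], which may live on a
    space of its own; this is the order in which bounds holding for every fixed
    value of the next input can be integrated. *)
Lemma ge0_integral_indep (Z : {mfun T >-> E1}) (Y : {mfun T >-> E2})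
    (Y0 : {mfun T0 >-> E2}) (F : E1 * E2 -> \bar R) :
  (forall A B, measurable A -> measurable B ->
     P (Z @^-1` A `&` Y @^-1` B) = P (Z @^-1` A) * P0 (Y0 @^-1` B)) ->
  measurable_fun setT F -> (forall x, 0 <= F x) ->
  \int[P]_w F (Z w, Y w) = \int[P0]_v \int[P]_w F (Z w, Y0 v).
Proof.
move=> ZY mF F0.
have mZY : measurable_fun setT (fun w => (Z w, Y w)).
  exact: measurable_fun_pair.
pose ZY' : {mfun T >-> (E1 * E2)%type} :=
  HB.pack (fun w => (Z w, Y w)) (isMeasurableFun.Build _ _ _ _ _ mZY).
have -> : \int[P]_w F (Z w, Y w) = \int[distribution P ZY']_z F z.
  by rewrite ge0_integral_distribution.
have prodE : forall W, measurable W -> distribution P ZY' W =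
    (distribution P Z \x distribution P0 Y0) W.
  move=> W mW; apply/esym.
  apply: (@product_measure_unique _ _ _ _ _ (distribution P Z)
    (distribution P0 Y0) (distribution P ZY')) => //.
rewrite (eq_measure_integral (distribution P Z \x distribution P0 Y0)); last first.
  by move=> A mA _; exact: prodE.
rewrite fubini_tonelli2//= ge0_integral_distribution//=; last 2 first.
- exact: measurable_fun_fubini_tonelli_G.
- by move=> y; apply: integral_ge0.
apply: eq_integral => v _ /=.
rewrite /fubini_G ge0_integral_distribution//.
exact: measurableT_comp.
Qed.
End independence.

(** * States driven by independent inputs *)

Section driven_recursion.
Context (R : realType) (d d1 d2 : measure_display).
Context (T : measurableType d).
Context (E1 : measurableType d1) (E2 : measurableType d2).
Context (P : probability T R).
Variables (Y : nat -> {mfun T >-> E2}) (Z : nat -> {mfun T >-> E1}).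
Variables (op : E1 * E2 -> E1) (z0 : E1).
Hypothesis mop : measurable_fun setT op.
Hypothesis Z0 : forall w, Z 0%N w = z0.
Hypothesis ZS : forall n w, Z n.+1 w = op (Z n w, Y n w).
Hypothesis indep : mutually_independent P (fun i w => Y i w).
Local Open Scope ereal_scope.

Local Notation bigY J A := (\bigcap_(i in [set` J]) (Y i @^-1` A i)).

Let mbigY (J : {fset nat}) A : (forall i, measurable (A i)) -> measurable (bigY J A).
Proof.
move=> mA; apply: fin_bigcap_measurable => // i _.
by rewrite -[_ @^-1` _]setTI; exact: measurable_funP.
Qed.

(** The state after [n] steps is a function of the first [n] inputs, hence
    independent of the inputs of index at least [n].  The induction has to speak
    of all finite families of such inputs, because the next state mixes the
    current one with an input that was part of the family. *)
Lemma driven_indep n (J : {fset nat}) (A : nat -> set E2) (B : set E1) :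
  (forall i, i \in J -> (n <= i)%N) -> (forall i, measurable (A i)) ->
  measurable B ->
  P (Z n @^-1` B `&` bigY J A) = P (Z n @^-1` B) * P (bigY J A).
Proof.
elim: n J A B => [|n IH] J A B Jn mA mB.
  have [Bz|Bz] := pselect (B z0).
    rewrite (_ : Z 0%N @^-1` B = setT) ?setTI ?probability_setT ?mul1e//.
    by apply/seteqP; split => // w _ /=; rewrite Z0.
  rewrite (_ : Z 0%N @^-1` B = set0) ?set0I ?measure0 ?mul0e//.
  by apply/seteqP; split => // w /=; rewrite Z0.
pose W := op @^-1` B.
have mW : measurable W by rewrite /W -[_ @^-1` _]setTI; exact: mop.
have ZSW : Z n.+1 @^-1` B = (fun w => (Z n w, Y n w)) @^-1` W.
  by apply/seteqP; split => w /=; rewrite ZS.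
(* the joint law of the state and the next input, on an event that depends on
   strictly later inputs only *)
have joint (J' : {fset nat}) A' : (forall i, i \in J' -> (n < i)%N) ->
    (forall i, measurable (A' i)) -> P (Z n.+1 @^-1` B `&` bigY J' A') =
    (distribution P (Z n) \x distribution P (Y n)) W * P (bigY J' A').
  move=> J'n mA'; rewrite ZSW; apply: joint_law_prod => //.
    exact: mbigY.
  move=> A1 A2 mA1 mA2.
  have nJ' : n \notin J' by apply/negP => /J'n; rewrite ltnn.
  pose A2' i := if i == n then A2 else A' i.
  have mA2' i : measurable (A2' i) by rewrite /A2'; case: ifP.
  have E : Y n @^-1` A2 `&` bigY J' A' = bigY (n |` J')%fset A2'.
    apply/seteqP; split => [w [/= Yw Aw] i /=|w Aw /=].
      rewrite !inE /A2' => /orP[/eqP ->|iJ]; first by rewrite eqxx.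
      by case: eqP => [->//|_]; exact: Aw.
    split; first by have := Aw n; rewrite /= /A2' eqxx !inE eqxx; exact.
    move=> i /= iJ; have := Aw i; rewrite /= !inE iJ orbT /A2' => /(_ isT).
    by case: eqP => // iE; move: nJ'; rewrite -iE iJ.
  rewrite -setIA E IH//; last first.
    by move=> i; rewrite !inE => /orP[/eqP ->//|/J'n/ltnW].
  rewrite -muleA; congr (_ * _).
  rewrite (indep _ mA2') (indep _ mA').
  rewrite (big_fsetD1 n)/= ?in_fset1U ?eqxx// {1}/A2' eqxx; congr (_ * _).
  rewrite fsetU1K// !big_seq; apply: eq_bigr => i iJ.
  by rewrite /A2'; case: eqP => // iE; move: nJ'; rewrite -iE iJ.
rewrite joint//; congr (_ * _).
have := joint fset0 A; rewrite set_fset0 bigcap_set0 setIT.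
by rewrite probability_setT mule1 => ->.
Qed.

Lemma driven_indep_next n (A : set E2) (B : set E1) :
  measurable A -> measurable B ->
  P (Z n @^-1` B `&` Y n @^-1` A) = P (Z n @^-1` B) * P (Y n @^-1` A).
Proof.
move=> mA mB.
have := @driven_indep n [fset n]%fset (fun=> A) B.
rewrite (_ : [set` [fset n]%fset] = [set n]) ?bigcap_set1; last first.
  by apply/seteqP; split => i /=; rewrite inE => /eqP.
by apply=> // i; rewrite inE => /eqP ->.
Qed.

End driven_recursion.

(** * Integrals of nonnegative real functions *)

Section almost_everywhere_integrals.
Context (R : realType) (d : measure_display) (T : measurableType d).
Variable P : probability T R.
Local Open Scope ereal_scope.

Lemma measurable_bool_nat (b : T -> bool) :
  measurable_fun setT b -> measurable_fun setT (fun x => (b x)%:R%R : R).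
Proof.
move=> mb; rewrite (_ : (fun x => _) = (fun x => if b x then 1 else 0)%R).
  exact: measurable_fun_ifT.
by apply/funext => x; case: (b x).
Qed.

Lemma ae_integral_gt0 (f : T -> R) :
  measurable_fun setT f -> (forall w, 0 <= f w)%R ->
  {ae P, forall w, (0 < f w)%R} -> 0 < \int[P]_w (f w)%:E.
Proof.
move=> mf f0 fpos; rewrite lt0e integral_ge0 ?andbT; last first.
  by move=> w _; rewrite lee_fin.
apply/eqP => If0.
have : \int[P]_w `|(f w)%:E| = 0.
  by rewrite -[RHS]If0; apply: eq_integral => w _; rewrite gee0_abs ?lee_fin.
move/(ae_eq_integral_abs P measurableT ((measurable_EFinP _ _).2 mf)) => f0ae.
have [N [_ PN0 N_full]] : \forall w \ae P, False.
  near=> w; have fw : (0 < f w)%R by near: w.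
  have : (f w)%:E = 0 by near: w; apply: filterS f0ae => x; exact.
  by case=> fw0; move: fw; rewrite fw0 ltxx.
have NT : N = setT by rewrite -subTset => w _; exact: N_full.
by move: PN0; rewrite NT probability_setT => /eqP; rewrite onee_eq0.
Unshelve. all: by end_near. Qed.

Lemma ae_le_integral (f g : T -> R) :
  measurable_fun setT f -> measurable_fun setT g ->
  (forall w, 0 <= f w)%R -> (forall w, 0 <= g w)%R ->
  {ae P, forall w, (f w <= g w)%R} ->
  \int[P]_w (f w)%:E <= \int[P]_w (g w)%:E.
Proof.
move=> mf mg f0 g0 fg; apply: ae_ge0_le_integral => //.
- by move=> w _; rewrite lee_fin.
- exact/measurable_EFinP.
- by move=> w _; rewrite lee_fin.
- exact/measurable_EFinP.
- by apply: filterS fg => w fgw _; rewrite lee_fin.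
Qed.

Lemma ae_eq_integral_real (f g : T -> R) :
  measurable_fun setT f -> measurable_fun setT g ->
  (forall w, 0 <= f w)%R -> (forall w, 0 <= g w)%R ->
  {ae P, forall w, (f w = g w)%R} ->
  \int[P]_w (f w)%:E = \int[P]_w (g w)%:E.
Proof.
move=> mf mg f0 g0 fg.
by apply/le_anti/andP; split; apply: ae_le_integral => //;
  apply: filterS fg => w ->.
Qed.

Lemma ge0_integrable (f : T -> R) :
  measurable_fun setT f -> (forall w, 0 <= f w)%R ->
  \int[P]_w (f w)%:E < +oo -> P.-integrable setT (EFin \o f).
Proof.
move=> mf f0 If; apply/integrableP; split; first exact/measurable_EFinP.
rewrite (_ : \int[P]_w _ = \int[P]_w (f w)%:E)//.
by apply: eq_integral => w _; rewrite gee0_abs ?lee_fin.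
Qed.

Lemma integralD_real (f g : T -> R) :
  measurable_fun setT f -> measurable_fun setT g ->
  (forall w, 0 <= f w)%R -> (forall w, 0 <= g w)%R ->
  \int[P]_w (f w + g w)%:E = \int[P]_w (f w)%:E + \int[P]_w (g w)%:E.
Proof.
move=> mf mg f0 g0; rewrite -ge0_integralD//.
- by move=> w _; rewrite lee_fin.
- exact/measurable_EFinP.
- by move=> w _; rewrite lee_fin.
- exact/measurable_EFinP.
Qed.

Lemma integralZ_real (k : R) (f : T -> R) :
  measurable_fun setT f -> (0 <= k)%R -> (forall w, 0 <= f w)%R ->
  \int[P]_w (k * f w)%:E = k%:E * \int[P]_w (f w)%:E.
Proof.
move=> mf k0 f0; rewrite -ge0_integralZl_EFin//.
- by move=> w _; rewrite lee_fin.
- exact/measurable_EFinP.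
Qed.

End almost_everywhere_integrals.

(** * Inequalities for the exponential *)

Section exponential_inequalities.
Variable R : realType.
Implicit Types x y s t : R.

(** Convexity between [0] and [y], read off the tangent line at [s * y]. *)
Lemma expR_convex0 s y : 0 <= s <= 1 -> expR (s * y) <= s * expR y + (1 - s).
Proof.
move=> /andP[s0 s1].
have tangent x : expR (s * y) * (1 + (x - s * y)) <= expR x.
  have -> : expR x = expR (s * y) * expR (x - s * y).
    by rewrite -expRD addrC subrK.
  by rewrite ler_pM2l ?expR_gt0// expR_ge1Dx.
have h1 := ler_wpM2l s0 (tangent y).
have s1' : 0 <= 1 - s by rewrite subr_ge0.
have := ler_wpM2l s1' (tangent 0); rewrite expR0 mulr1 => h0.
apply: le_trans (lerD h1 h0); set z := expR (s * y).
by rewrite le_eqVlt; apply/orP; left; apply/eqP; ring.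
Qed.

Lemma le_expR_norm x y : `|x| <= `|y| -> expR x <= expR y + expR (- y).
Proof.
move=> xy; apply: (@le_trans _ _ (expR `|y|)).
  by rewrite ler_expR (le_trans (ler_norm x)).
by case: (ger0P y) => _; rewrite ?lerDl ?lerDr expR_ge0.
Qed.

End exponential_inequalities.

(** * The Laplace transform and its root *)

Section laplace_exponent.
Context (R : realType) (d : measure_display) (T : measurableType d).
Variables (P : probability T R) (tau X : {RV P >-> R}).
Hypothesis tau_gt0 : {ae P, forall w, 0 < tau w}.

Definition laplace (l e : R) : \bar R :=
  (\int[P]_w (expR (l * X w - e * tau w))%:E)%E.

Lemma measurable_weight l e :
  measurable_fun setT (fun w => expR (l * X w - e * tau w)).
Proof.
apply: measurableT_comp => //.
by apply: measurable_funB; exact: measurable_funM.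
Qed.

Lemma weight_ge0 l e w : 0 <= expR (l * X w - e * tau w).
Proof. exact: expR_ge0. Qed.
#[local] Hint Resolve measurable_weight weight_ge0 : core.

Lemma laplace_gt0 l e : (0 < laplace l e)%E.
Proof. by apply: ae_integral_gt0 => //; apply: aeW => w; exact: expR_gt0. Qed.

(** The value at the larger exponent is required to be finite; at the smaller
    one the transform may be infinite, as happens at [0]. *)
Lemma laplace_decreasing l a b : a < b -> (laplace l b < +oo)%E ->
  (laplace l b < laplace l a)%E.
Proof.
move=> ab lb_fin.
pose gap w := `|expR (l * X w - a * tau w) - expR (l * X w - b * tau w)|.
have mgap : measurable_fun setT gap.
  by apply: measurableT_comp => //; exact: measurable_funB.
have gap0 w : 0 <= gap w by exact: normr_ge0.
have gapE : {ae P, forall w, 0 < gap w /\ expR (l * X w - a * tau w) =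
    expR (l * X w - b * tau w) + gap w}.
  apply: filterS tau_gt0 => w tw; rewrite /gap.
  have lt_w : expR (l * X w - b * tau w) < expR (l * X w - a * tau w).
    by rewrite ltr_expR ltrD2l ltrN2 ltr_pM2r.
  rewrite normr_gt0 subr_eq0 gt_eqF//; split=> //.
  by rewrite gtr0_norm ?subr_gt0// [RHS]addrC subrK.
rewrite [ltRHS](_ : _ = (laplace l b + \int[P]_w (gap w)%:E)%E); last first.
  rewrite /laplace -integralD_real//; apply: ae_eq_integral_real => //.
  - exact: measurable_funD.
  - by move=> w; rewrite addr_ge0.
  - by apply: filterS gapE => w [].
rewrite lteDl ?ge0_fin_numE ?(ltW (laplace_gt0 _ _))//.
by apply: ae_integral_gt0 => //; apply: filterS gapE => w [].
Qed.

Lemma laplace_inj l a b : laplace l a = 1%E -> laplace l b = 1%E -> a = b.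
Proof.
move=> la lb; have [ab|ba|//] := ltgtP a b.
- have := @laplace_decreasing l a b ab; rewrite la lb ltxx.
  by move=> /(_ (ltry _)).
- have := @laplace_decreasing l b a ba; rewrite la lb ltxx.
  by move=> /(_ (ltry _)).
Qed.

Lemma laplace_root_le l a b : laplace l a = 1%E -> (laplace l b <= 1)%E ->
  a <= b.
Proof.
move=> la lb; rewrite leNgt; apply/negP => ba.
have := @laplace_decreasing l _ _ ba; rewrite la => /(_ (ltry _)).
by rewrite ltNge lb.
Qed.

(** Convexity of the transform along the segment from the origin, where it
    equals [1], to the point [(l, e)]. *)
Lemma laplace_scale s l e : 0 <= s <= 1 -> laplace l e = 1%E ->
  (laplace (s * l) (s * e) <= 1)%E.
Proof.
move=> s01 le1; have /andP[s0 s1] := s01.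
apply: (@le_trans _ _
    (\int[P]_w (s * expR (l * X w - e * tau w) + (1 - s))%:E)%E).
  apply: ae_le_integral => //.
  - apply: measurable_funD => //; exact: measurable_funM.
  - by move=> w; rewrite addr_ge0 ?subr_ge0// mulr_ge0.
  - apply: aeW => w.
    rewrite (_ : _ - _ = s * (l * X w - e * tau w)); last by ring.
    exact: expR_convex0.
rewrite integralD_real//; last 3 first.
- exact: measurable_funM.
- by move=> w; rewrite mulr_ge0.
- by move=> w; rewrite subr_ge0.
rewrite integralZ_real// -/(laplace l e) le1 mule1.
by rewrite integral_cst//= probability_setT mule1 -EFinD addrC subrK.
Qed.

Hypothesis Etau : (\int[P]_w (tau w)%:E < +oo)%E.
Hypothesis Eexp : forall l e, 0 < e -> (laplace l e < +oo)%E.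
Hypothesis EX : (\int[P]_w (X w)%:E = 0)%E.

Lemma norm_tau_lty : (\int[P]_w (`|tau w|)%:E < +oo)%E.
Proof.
rewrite (_ : (\int[P]_w _)%E = (\int[P]_w (tau w)%:E)%E)//.
apply: ae_eq_integral => //.
- by apply/measurable_EFinP; apply: measurableT_comp.
- exact/measurable_EFinP.
- by apply: filterS tau_gt0 => w tw _; rewrite gtr0_norm.
Qed.

(** Both tails of [X] are controlled by [x <= exp (x - s) + s] with [s = tau]. *)
Lemma integrable_reward : P.-integrable setT (EFin \o X).
Proof.
pose dom w := expR (1 * X w - 1 * tau w) + expR (-1 * X w - 1 * tau w)
  + `|tau w|.
have mdom : measurable_fun setT dom.
  apply: measurable_funD; first exact: measurable_funD.
  exact: measurableT_comp.
have mnorm : measurable_fun setT (fun w => `|tau w|) by exact: measurableT_comp.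
have dom0 w : 0 <= dom w by rewrite !addr_ge0.
apply: (@le_integrable _ _ _ _ _ measurableT (EFin \o X) (EFin \o dom)).
- exact/measurable_EFinP.
- move=> w _; rewrite /= lee_fin (ger0_norm (dom0 w)) /dom.
  have e1 := expR_ge1Dx (1 * X w - 1 * tau w).
  have e2 := expR_ge1Dx (-1 * X w - 1 * tau w).
  have p1 := expR_ge0 (1 * X w - 1 * tau w).
  have p2 := expR_ge0 (-1 * X w - 1 * tau w).
  have := ler_norm (tau w) => tt.
  by case: (ger0P (X w)) => _; lra.
- apply: ge0_integrable => //.
  rewrite integralD_real//; last exact: measurable_funD.
  rewrite integralD_real//; apply: lte_add_pinfty; last exact: norm_tau_lty.
  by apply: lte_add_pinfty; [exact: (Eexp 1 ltr01)|exact: (Eexp (-1) ltr01)].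
Qed.

(** The linear part of [exp (l X)] integrates to [1] because [X] is centred;
    the remaining integrand is nonnegative, and vanishes only where [l X] does.
    This yields both the bound at [0] and its equality case. *)
Lemma laplace0_expand l : (laplace l 0 < +oo)%E ->
  (laplace l 0 = 1 + \int[P]_w (expR (l * X w) - (1 + l * X w))%:E)%E.
Proof.
move=> l0.
have iexp : P.-integrable setT (EFin \o (fun w => expR (l * X w - 0 * tau w))).
  exact: ge0_integrable.
have i1 : P.-integrable setT (EFin \o (fun=> 1 : R)).
  exact: finite_measure_integrable_cst.
have ilX : P.-integrable setT (EFin \o (fun w => l * X w)).
  by have := integrableZl measurableT l integrable_reward.
have ilin : P.-integrable setT (EFin \o (fun w => 1 + l * X w)).
  by have := integrableD measurableT i1 ilX.
have lin1 : (\int[P]_w (1 + l * X w)%:E = 1)%E.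
  rewrite integralD_EFin// integral_cst//= probability_setT mule1.
  under eq_integral do rewrite EFinM.
  by rewrite integralZl//; [rewrite EX mule0 adde0|exact: integrable_reward].
under eq_integral => w _.
  rewrite (_ : expR (l * X w) = expR (l * X w - 0 * tau w)); last first.
    by rewrite mul0r subr0.
  over.
by rewrite integralB_EFin// lin1 [RHS]addeC subeK.
Qed.

Lemma laplace0_ge1 l : (1 <= laplace l 0)%E.
Proof.
have [l0|] := ltP (laplace l 0) +oo%E; last by rewrite leye_eq => /eqP ->; rewrite leey.
rewrite laplace0_expand// leeDl// integral_ge0// => w _.
by rewrite lee_fin subr_ge0 expR_ge1Dx.
Qed.

Lemma laplace0_eq1 l : l != 0 -> laplace l 0 = 1%E ->
  {ae P, forall w, X w = 0}.
Proof.
move=> l_neq0 l1.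
have := laplace0_expand; move=> /(_ l); rewrite l1 => /(_ (ltry _)).
set I := (\int[P]_w _)%E => E.
have I0 : I = 0%E.
  have : (1 + I - 1 = 0)%E by rewrite -E subee.
  by rewrite addeAC subee ?add0e.
have mexc : measurable_fun setT (fun w => expR (l * X w) - (1 + l * X w)).
  apply: measurable_funB.
    by apply: measurableT_comp => //; exact: measurable_funM.
  by apply: measurable_funD => //; exact: measurable_funM.
have /(ae_eq_integral_abs P measurableT ((measurable_EFinP _ _).2 mexc)) :
    (\int[P]_w `|(expR (l * X w) - (1 + l * X w))%:E| = 0)%E.
  rewrite -[RHS]I0; apply: eq_integral => w _.
  by rewrite gee0_abs// lee_fin subr_ge0 expR_ge1Dx.
apply: filterS => w /(_ Logic.I) [] /eqP; rewrite subr_eq0 => /eqP expE.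
have [/eqP|lX0] := eqVneq (l * X w) 0.
  by rewrite mulf_eq0 (negbTE l_neq0) /= => /eqP.
by have := expR_gt1Dx lX0; rewrite expE ltxx.
Qed.
(** Monotone convergence as the exponent decreases to [0]. *)
Lemma laplace0_le1 l : (forall e, 0 < e -> (laplace l e <= 1)%E) ->
  (laplace l 0 <= 1)%E.
Proof.
move=> le1.
pose f (n : nat) w := (expR (l * X w - n.+1%:R^-1 * `|tau w|))%:E.
have mf n : measurable_fun setT (f n).
  apply/measurable_EFinP; apply: measurableT_comp => //.
  apply: measurable_funB; first exact: measurable_funM.
  by apply: measurable_funM => //; exact: measurableT_comp.
have f0 n w : (0 <= f n w)%E by rewrite lee_fin expR_ge0.
have f_mono w : {homo f^~ w : n m / (n <= m)%N >-> (n <= m)%E}.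
  move=> n m nm; rewrite lee_fin ler_expR lerD2l lerN2 ler_wpM2r//.
  by rewrite lef_pV2 ?posrE// ler_nat.
have If n : (\int[P]_w f n w <= 1)%E.
  apply: le_trans (le1 n.+1%:R^-1 _) => //.
  apply: ae_le_integral => //.
  - exact/measurable_EFinP/(mf n).
  - by apply: filterS tau_gt0 => w tw; rewrite gtr0_norm.
have := @monotone_convergence _ _ _ P _ measurableT f mf
  (fun n w _ => f0 n w) (fun w _ => f_mono w).
rewrite (_ : (fun w => limn (f^~ w)) =
    (fun w => (expR (l * X w - 0 * tau w))%:E)); last first.
  apply/funext => w; apply/cvg_lim => //; apply: cvg_EFin.
    by near=> n; rewrite /f.
  apply: continuous_cvg; first exact: continuous_expR.
  rewrite [X in _ --> X](_ : _ = l * X w - 0 * `|tau w|); last first.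
    by rewrite !mul0r.
  apply: cvgB; first exact: cvg_cst.
  by apply: cvgMr_tmp; exact: cvg_harmonic.
rewrite /laplace => ->; apply: lime_le; last by apply: nearW.
apply: ereal_nondecreasing_is_cvgn => n m nm.
by apply: ge0_le_integral => // w _; exact: f_mono.
Unshelve. all: by end_near. Qed.

(** Dominated convergence as the exponent tends to infinity. *)
Lemma laplace_lt1 l : exists2 b, 0 < b & (laplace l b < 1)%E.
Proof.
pose f (n : nat) w := (expR (l * X w - n.+1%:R * tau w))%:E.
have mf n : measurable_fun setT (f n) by exact/measurable_EFinP.
have ig : P.-integrable setT (EFin \o (fun w => expR (l * X w - 1 * tau w))).
  by apply: ge0_integrable => //; exact: Eexp.
have [] := @dominated_convergence _ _ _ P _ measurableT f (cst 0%E) _ mf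
  (measurable_cst _) _ ig.
- apply: filterS tau_gt0 => w tw _; apply: cvg_EFin.
    by near=> n; rewrite /f.
  have -> : fine \o f^~ w =
      (fun n : nat => expR (l * X w) * expR (- (n.+1%:R * tau w))).
    by apply/funext => n; rewrite /= expRD.
  rewrite -[X in _ --> X](mulr0 (expR (l * X w))).
  apply: cvgMl_tmp.
  apply: (@cvg_comp _ _ _ (fun n : nat => n.+1%:R * tau w) (fun x => expR (- x))
    _ +oo); last exact: cvgr_expR.
  apply/cvgryPge => A; near=> n.
  rewrite -ler_pdivrMr//; near: n.
  exists (Num.trunc (A / tau w)) => // n /=; rewrite -(ler_nat R) => h.
  by rewrite (le_trans (ltW (truncnS_gt _)))// ler_nat ltnS -(ler_nat R).
- apply: filterS tau_gt0 => w tw n _.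
  rewrite gee0_abs ?lee_fin// ?expR_ge0// ler_expR lerD2l lerN2 ler_wpM2r ?(ltW tw)//.
  by rewrite ler1n.
move=> _ _; rewrite integral0 => /fine_cvgP[_] /cvgr_lt.
move=> /(_ 1 ltr01) [n _ /(_ n (leqnn n))] /=.
exists n.+1%:R => //; rewrite /laplace.
rewrite -(@fineK _ (\int[P]_w _)%E) ?lte_fin//.
by rewrite ge0_fin_numE ?Eexp// ltW// laplace_gt0.
Unshelve. all: by end_near. Qed.

Lemma laplace_continuous l a : 0 < a ->
  {in `]a, +oo[%classic, continuous (fun e => fine (laplace l e))}.
Proof.
move=> a0 x; rewrite inE/= in_itv/= andbT => ax.
have := @continuity_under_integral _ _ _ P (fun e w => expR (l * X w - e * tau w))
  _ measurableT a (x + 1) _ _ _ _ _ x.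
apply.
- move=> e /=; rewrite in_itv/= => /andP[ae _].
  by apply: ge0_integrable => //; apply: Eexp; exact: lt_trans ae.
- apply: aeW => w _ e _; apply: continuous_comp; last exact: continuous_expR.
  apply: cvgB; first exact: cvg_cst.
  by apply: cvgMr_tmp; exact: cvg_id.
- exact: (ge0_integrable (measurable_weight l a) (weight_ge0 l a) (Eexp _ a0)).
- move=> e /=; rewrite in_itv/= => /andP[ae _].
  apply: filterS tau_gt0 => w tw _.
  by rewrite ger0_norm// ler_expR lerD2l lerN2 ler_wpM2r// ltW.
- by rewrite inE/= in_itv/= ax ltrDl ltr01.
Qed.

(** If the transform stays below [1] on the positive axis, the root is [0] by the
    centring of [X]; otherwise the intermediate value theorem applies. *)
Lemma laplace_root l : exists2 e, 0 <= e & laplace l e = 1%E.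
Proof.
have [le1|] := pselect (forall e, 0 < e -> (laplace l e <= 1)%E).
  exists 0 => //; apply/le_anti/andP; split; first exact: laplace0_le1.
  exact: laplace0_ge1.
move=> /existsNP[a] /not_implyP[a0] /negP; rewrite -ltNge => a1.
have [b b0 b1] := laplace_lt1 l.
have fin e : 0 < e -> laplace l e \is a fin_num.
  by move=> e0; rewrite ge0_fin_numE ?Eexp// ltW// laplace_gt0.
have ab : a <= b.
  rewrite leNgt; apply/negP => ba.
  have := laplace_decreasing ba (Eexp l a0).
  by rewrite ltNge (ltW (lt_trans b1 a1)).
have fa : 1 < fine (laplace l a) by rewrite -lte_fin fineK ?fin.
have fb : fine (laplace l b) < 1 by rewrite -lte_fin fineK ?fin.
have [||e /[!in_itv]/=/andP[ae eb] fe] :=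
    @IVT R (fun e => fine (laplace l e)) a b 1 ab.
- apply: continuous_in_subspaceT => x; rewrite inE/= in_itv/= => /andP[ax _].
  apply: (@laplace_continuous l (a / 2)); first by rewrite divr_gt0.
  rewrite inE/= in_itv/= andbT (lt_le_trans _ ax)//.
  by rewrite ltr_pdivrMr// ltr_pMr// ltr1n.
- by rewrite ge_min le_max (ltW fa) (ltW fb) orbT.
have e0 : 0 < e by exact: lt_le_trans ae.
by exists e; [exact: ltW|rewrite -(fineK (fin _ e0)) fe].
Qed.

(** * Estimates uniform in the tilting parameter *)

Variable eta : R -> R.
Hypothesis eta_ge0 : forall l, 0 <= eta l.
Hypothesis etaP : forall l, laplace l (eta l) = 1%E.
Variables c C : R.
Hypotheses (c0 : 0 < c) (cC : c <= C).

(** By [laplace_scale] the root at [s * l] is even at most [s * eta l]: the ratio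
    [eta l / l] is monotone on each half-line. *)
Lemma eta_scale s l : 0 <= s <= 1 -> eta (s * l) <= eta l.
Proof.
move=> s01; have /andP[s0 s1] := s01.
apply: (@le_trans _ _ (s * eta l)); last by rewrite ler_piMl.
apply: (laplace_root_le (etaP _)); exact: laplace_scale.
Qed.

Lemma eta_bounds l : c <= `|l| <= C ->
  Num.min (eta c) (eta (- c)) <= eta l <= Num.max (eta C) (eta (- C)).
Proof.
have scale a b : 0 < a -> a <= b -> eta a <= eta b /\ eta (- a) <= eta (- b).
  move=> a0 ab; have b0 := lt_le_trans a0 ab.
  have s01 : 0 <= a / b <= 1.
    by rewrite divr_ge0 ?(ltW a0) ?(ltW b0)// ler_pdivrMr// mul1r.
  have abb : a / b * b = a by rewrite divfK ?gt_eqF.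
  split; first by rewrite -{1}abb eta_scale.
  by rewrite -{1}abb -mulrN eta_scale.
move=> /andP[cl lC].
have l0 := lt_le_trans c0 cl.
have [cl1 cl2] := scale _ _ c0 cl; have [lC1 lC2] := scale _ _ l0 lC.
rewrite ge_min le_max; case: (lerP 0 l) => ll.
- by move: cl1 lC1; rewrite ger0_norm// => -> ->.
- by move: cl2 lC2; rewrite ltr0_norm// opprK => -> ->; rewrite !orbT.
Qed.

(** The weight is at least [exp (- (C |X| + H tau))], where [H] bounds [eta] on
    the range; this minorant no longer depends on [l]. *)
Lemma drift_lower_bound : exists2 delta : R, 0 < delta &
  forall l, c <= `|l| <= C -> (delta%:E <= \int[P]_w
    (expR (l * X w - eta l * tau w) * Num.min `|tau w| 1)%:E)%E.
Proof.
pose H := Num.max (eta C) (eta (- C)).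
have H0 : 0 <= H by rewrite le_max eta_ge0.
pose f w := expR (- (C * `|X w| + H * `|tau w|)) * Num.min `|tau w| 1.
have mf : measurable_fun setT f.
  apply: measurable_funM; last first.
    by apply: measurable_minr => //; exact: measurableT_comp.
  apply: measurableT_comp => //; apply: measurableT_comp => //.
  by apply: measurable_funD; apply: measurable_funM => //;
    exact: measurableT_comp.
have f0 w : 0 <= f w by rewrite mulr_ge0 ?expR_ge0// le_min normr_ge0 ler01.
have fI : (\int[P]_w (f w)%:E <= 1)%E.
  apply: (@le_trans _ _ (\int[P]_w (1 : R)%:E)%E).
    apply: ae_le_integral => //; apply: aeW => w.
    rewrite -[leRHS]mul1r; apply: ler_pM.
    - exact: expR_ge0.
    - by rewrite le_min normr_ge0 ler01.
    - rewrite -[leRHS]expR0 ler_expR oppr_le0 addr_ge0 ?mulr_ge0//.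
      exact: le_trans (ltW c0) cC.
    - by rewrite ge_min lexx orbT.
  by rewrite integral_cst//= probability_setT mule1.
have fI0 : (0 < \int[P]_w (f w)%:E)%E.
  apply: ae_integral_gt0 => //; apply: filterS tau_gt0 => w tw.
  by rewrite mulr_gt0 ?expR_gt0// lt_min normr_gt0 gt_eqF// ltr01.
have fin : (\int[P]_w (f w)%:E)%E \is a fin_num.
  by rewrite ge0_fin_numE ?(ltW fI0)// (le_lt_trans fI)// ltry.
exists (fine (\int[P]_w (f w)%:E)); first by rewrite -lte_fin fineK.
move=> l cl; rewrite fineK//.
have /andP[_ etaH] := eta_bounds cl; have /andP[_ lC] := cl.
have mmin : measurable_fun setT (fun w => Num.min `|tau w| 1).
  by apply: measurable_minr => //; exact: measurableT_comp.
apply: ae_le_integral => //.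
  exact: measurable_funM.
apply: filterS tau_gt0 => w tw.
rewrite ler_wpM2r ?le_min ?normr_ge0 ?ler01// ler_expR opprD lerD//.
  rewrite lerNl -mulNr (le_trans (ler_norm _))// normrM normrN.
  by rewrite ler_wpM2r.
by rewrite lerN2 gtr0_norm// ler_wpM2r// ltW.
Qed.

(** When [eta] is bounded below by some [m > 0] on the range, half of the
    exponential decay absorbs the factor [1 + tau] and the other half keeps the
    transform finite.  Otherwise [eta] vanishes at [c] or [- c], [X] vanishes by
    [laplace0_eq1], and the bound is the mean of [1 + tau]. *)
Lemma tilted_overshoot_bound : exists B : R,
  forall l, c <= `|l| <= C -> (\int[P]_w
    ((1 + `|tau w|) * expR ((2 * l) * X w - eta l * tau w))%:E <= B%:E)%E.
Proof.
have mntau : measurable_fun setT (fun w => `|tau w|) by exact: measurableT_comp.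
have m1tau : measurable_fun setT (fun w => 1 + `|tau w|).
  exact: measurable_funD.
have tau10 w : 0 <= 1 + `|tau w| by rewrite addr_ge0.
have mF l e : measurable_fun setT
    (fun w => (1 + `|tau w|) * expR (l * X w - e * tau w)).
  exact: measurable_funM.
have F0 l e w : 0 <= (1 + `|tau w|) * expR (l * X w - e * tau w).
  by rewrite mulr_ge0.
pose m := Num.min (eta c) (eta (- c)).
have [m0|m_le0] := ltP 0 m; last first.
  have X0 : {ae P, forall w, X w = 0}.
    have c_neq0 : c != 0 by rewrite gt_eqF.
    have e0 l : l != 0 -> eta l <= 0 -> {ae P, forall w, X w = 0}.
      move=> l_neq0 el; apply: (laplace0_eq1 l_neq0).
      by rewrite -(etaP l); congr laplace; apply/le_anti; rewrite eta_ge0 el.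
    move: m_le0; rewrite ge_min => /orP[]; first exact: e0.
    by apply: e0; rewrite oppr_eq0.
  exists (1 + fine (\int[P]_w `|tau w|%:E)) => l _.
  rewrite EFinD fineK; last first.
    rewrite ge0_fin_numE; first exact: norm_tau_lty.
    by apply: integral_ge0 => w _; rewrite lee_fin.
  have -> : (1%:E + \int[P]_w `|tau w|%:E = \int[P]_w (1 + `|tau w|)%:E)%E.
    by rewrite integralD_real// integral_cst//= probability_setT mule1.
  apply: ae_le_integral => //; apply: filterS2 tau_gt0 X0 => w tw ->.
  rewrite mulr0 sub0r ler_piMr// -expR0 ler_expR oppr_le0.
  by rewrite mulr_ge0// ltW.
have m20 : 0 < m / 2 by rewrite divr_gt0.
pose k := 1 + (m / 2)^-1.
have k0 : 0 <= k by rewrite addr_ge0// invr_ge0 ltW.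
exists (k * (fine (laplace (2 * C) (m / 2)) +
             fine (laplace (- (2 * C)) (m / 2)))) => l cl.
have fin a : laplace a (m / 2) \is a fin_num.
  by rewrite ge0_fin_numE ?Eexp// ltW// laplace_gt0.
rewrite [leRHS](_ : _ = k%:E *
    (laplace (2 * C) (m / 2) + laplace (- (2 * C)) (m / 2)))%E; last first.
  by rewrite -[X in (_ * (X + _))%E]fineK// -[X in (_ * (_ + X))%E]fineK.
rewrite -integralD_real// -integralZ_real//; last exact: measurable_funD.
have /andP[meta _] := eta_bounds cl; have /andP[_ lC] := cl.
apply: ae_le_integral => //.
- by apply: measurable_funM => //; exact: measurable_funD.
- by move=> w; rewrite mulr_ge0// addr_ge0.
apply: filterS tau_gt0 => w tw; rewrite (gtr0_norm tw).
apply: (@le_trans _ _ (k * expR (m / 2 * tau w) *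
    (expR (2 * C * X w - m * tau w) + expR (- (2 * C) * X w - m * tau w)))).
  apply: ler_pM; rewrite ?addr_ge0 ?expR_ge0 ?(ltW tw)//.
    have h1 := expR_ge1Dx (m / 2 * tau w).
    rewrite mulrDl mul1r lerD//.
      by rewrite (le_trans _ h1)// lerDl mulr_ge0 ?ltW.
    rewrite ler_pdivlMl//; apply: le_trans h1; by rewrite lerDr.
  rewrite !expRD mulNr -mulrDl ler_pM ?expR_ge0//.
    apply: le_expR_norm; rewrite !normrM !(ger0_norm (ler0n _ 2)).
    have C0 : 0 <= C by exact: le_trans (ltW c0) cC.
    by rewrite (ger0_norm C0) ler_wpM2r// ler_wpM2l.
  by rewrite ler_expR lerN2 ler_wpM2r// ltW.
rewrite -mulrA ler_wpM2l// mulrDr -!expRD le_eqVlt; apply/orP; left.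
by apply/eqP; congr (expR _ + expR _); field.
Qed.

End laplace_exponent.

(** * The walk of renewal times and accumulated rewards *)

Section renewal_walk.
Context (R : realType) (d0 d : measure_display).
Context (T0 : measurableType d0) (T : measurableType d).
Variables (P0 : probability T0 R) (P : probability T R).
Variables (tau X : {RV P0 >-> R}) (tau_ X_ : nat -> {RV P >-> R}).
Hypothesis copies : forall i : nat,
  same_distribution P P0 (fun w => (tau_ i w, X_ i w))
                         (fun w => (tau w, X w)).
Hypothesis indep : mutually_independent P
  (fun (i : nat) (w : T) => (tau_ i w, X_ i w)).
Hypothesis tau_gt0 : {ae P0, forall w, 0 < tau w}.

Definition walk_time n w : R := renewal_time (fun i => tau_ i : T -> R) n w.
Definition walk_reward n w : R := \sum_(i < n) X_ i w.

Local Notation step n w := (tau_ n w, X_ n w).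
Local Notation step0 w := (tau w, X w).
Definition walk_state n w : R * R := (walk_time n w, walk_reward n w).

Lemma walk_timeS n w : walk_time n.+1 w = walk_time n w + tau_ n w.
Proof. by rewrite /walk_time /renewal_time big_ord_recr. Qed.

Lemma walk_rewardS n w : walk_reward n.+1 w = walk_reward n w + X_ n w.
Proof. by rewrite /walk_reward big_ord_recr. Qed.

Lemma walk_time0 w : walk_time 0 w = 0.
Proof. by rewrite /walk_time /renewal_time big_ord0. Qed.

Lemma walk_reward0 w : walk_reward 0 w = 0.
Proof. by rewrite /walk_reward big_ord0. Qed.

Lemma measurable_walk_time n : measurable_fun setT (walk_time n).
Proof. exact: measurable_sum. Qed.

Lemma measurable_walk_reward n : measurable_fun setT (walk_reward n).
Proof. exact: measurable_sum. Qed.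
#[local] Hint Resolve measurable_walk_time measurable_walk_reward : core.

Let mstate n : measurable_fun setT (walk_state n).
Proof. exact: measurable_fun_pair. Qed.

Let mstep n : measurable_fun setT (fun w => step n w).
Proof. exact: measurable_fun_pair. Qed.

Let mstep0 : measurable_fun setT (fun w => step0 w).
Proof. exact: measurable_fun_pair. Qed.

Let state_rv n : {mfun T >-> (R * R)%type} :=
  HB.pack (walk_state n) (isMeasurableFun.Build _ _ _ _ _ (mstate n)).
Let step_rv n : {mfun T >-> (R * R)%type} :=
  HB.pack (fun w => step n w)
    (isMeasurableFun.Build _ _ _ _ _ (mstep n)).
Let step0_rv : {mfun T0 >-> (R * R)%type} :=
  HB.pack (fun w => step0 w) (isMeasurableFun.Build _ _ _ _ _ mstep0).

Let shift (p : (R * R) * (R * R)) : R * R := (p.1.1 + p.2.1, p.1.2 + p.2.2).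

(** [walk_state n] depends on the steps before the [n]-th one only, which can
    therefore be replaced by a copy of the pair on its own space. *)
Lemma walk_integral n (F : (R * R) * (R * R) -> \bar R) :
  measurable_fun setT F -> (forall p, 0 <= F p)%E ->
  (\int[P]_w F (walk_state n w, step n w) =
   \int[P0]_v \int[P]_w F (walk_state n w, step0 v))%E.
Proof.
move=> mF F0.
apply: (@ge0_integral_indep _ _ _ _ _ _ _ _ _ P P0 (state_rv n) (step_rv n)
  step0_rv F) => // A B mA mB.
rewrite -[P0 _](copies n mB).
apply: (@driven_indep_next _ _ _ _ _ _ _ _ step_rv state_rv shift (0, 0)).
- apply: measurable_fun_pair => /=; apply: measurable_funD;
    by apply: measurableT_comp.
- by move=> w; rewrite /= /walk_state walk_time0 walk_reward0.
- by move=> k w; rewrite /= /walk_state walk_timeS walk_rewardS.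
- exact: indep.
- exact: mB.
- exact: mA.
Qed.

Lemma measurable_walk_integral n (F : (R * R) * (R * R) -> \bar R) :
  measurable_fun setT F -> (forall p, 0 <= F p)%E ->
  measurable_fun setT (fun v => \int[P]_w F (walk_state n w, step0 v))%E.
Proof.
move=> mF F0.
pose G (p : T0 * T) := F (walk_state n p.2, step0 p.1).
apply: (@measurable_fun_fubini_tonelli_F _ _ _ _ _ P G).
  apply: (measurableT_comp mF); apply: measurable_fun_pair => /=.
    by apply: (measurableT_comp (mstate n)).
  by apply: (measurableT_comp mstep0).
by move=> p; exact: F0.
Qed.

Lemma walk_integral_prod n (a b : R * R -> R) :
  measurable_fun setT a -> measurable_fun setT b ->
  (forall z, 0 <= a z) -> (forall y, 0 <= b y) ->
  (\int[P]_w (a (walk_state n w) * b (step n w))%:E =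
   \int[P]_w (a (walk_state n w))%:E * \int[P0]_v (b (step0 v))%:E)%E.
Proof.
move=> ma mb a0 b0.
have maZ : measurable_fun setT (fun w => a (walk_state n w)).
  exact: measurableT_comp.
have mbY : measurable_fun setT (fun v => b (step0 v)).
  exact: measurableT_comp.
rewrite (@walk_integral n (fun p => (a p.1 * b p.2)%:E))/=; last 2 first.
- apply/measurable_EFinP; apply: measurable_funM; exact: measurableT_comp.
- by move=> p; rewrite lee_fin mulr_ge0.
under eq_integral => v _.
  under eq_integral do rewrite mulrC.
  rewrite integralZ_real// muleC.
  over.
rewrite ge0_integralZl//.
- exact/measurable_EFinP.
- by move=> v _; rewrite lee_fin.
- by apply: integral_ge0 => w _; rewrite lee_fin.
Qed.

Lemma walk_step_gt0 n : {ae P, forall w, 0 < tau_ n w}.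
Proof.
pose A := [set p : R * R | p.1 <= 0].
have mA : measurable A.
  rewrite (_ : A = fst @^-1` `]-oo, 0]%classic); last first.
    by apply/seteqP; split => p; rewrite /A/= in_itv.
  by rewrite -[_ @^-1` _]setTI; exact: measurable_fst.
have mA0 : measurable ((fun w => step0 w) @^-1` A).
  by rewrite -[_ @^-1` _]setTI; exact: mstep0.
have PA0 : P0 ((fun w => step0 w) @^-1` A) = 0%E.
  apply: measure_negligible => //; apply: negligibleS tau_gt0 => w /=.
  by rewrite /A/= leNgt => /negP.
exists ((fun w => step n w) @^-1` A); split.
- by rewrite -[_ @^-1` _]setTI; exact: mstep.
- by rewrite (copies n mA).
- by move=> w /= /negP; rewrite -leNgt.
Qed.
(** * The tilted walk *)

Definition tilt (l e : R) (z : R * R) : R := expR (l * z.2 - e * z.1).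

Variables l e : R.
Hypothesis root1 : laplace tau X l e = 1%E.

Lemma measurable_tilt : measurable_fun setT (tilt l e).
Proof.
apply: measurableT_comp => //.
by apply: measurable_funB; apply: measurable_funM.
Qed.

Lemma tilt_ge0 z : 0 <= tilt l e z. Proof. exact: expR_ge0. Qed.
#[local] Hint Resolve measurable_tilt tilt_ge0 : core.

Lemma tiltS n w :
  tilt l e (walk_state n.+1 w) = tilt l e (walk_state n w) * tilt l e (tau_ n w, X_ n w).
Proof.
rewrite /tilt /walk_state walk_timeS walk_rewardS -expRD /=.
by congr expR; ring.
Qed.

Lemma tilt0 w : tilt l e (walk_state 0 w) = 1.
Proof.
by rewrite /tilt /walk_state walk_time0 walk_reward0 /= !mulr0 subrr expR0.
Qed.

(** The tilts form a martingale of mean one along the walk, so this is the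
    expectation of [h (T_n)] under the law having that martingale as density. *)
Definition tilted_mean n (h : R -> R) : \bar R :=
  (\int[P]_w (tilt l e (walk_state n w) * h (walk_time n w))%:E)%E.

Let mtilt n : measurable_fun setT (fun w => tilt l e (walk_state n w)).
Proof.
exact: (measurableT_comp measurable_tilt (mstate n)).
Qed.

Let mtstep n : measurable_fun setT (fun w => tilt l e (tau_ n w, X_ n w)).
Proof. by apply: measurableT_comp => //; exact: measurable_fun_pair. Qed.

Let mtime (h : R -> R) n : measurable_fun setT h ->
  measurable_fun setT (fun w => h (walk_time n w)).
Proof.
by move=> mh; apply: measurableT_comp => //; exact: measurable_walk_time.
Qed.

Lemma tilted_mean_ge0 n h : (forall x, 0 <= h x) -> (0 <= tilted_mean n h)%E.
Proof. by move=> h0; apply: integral_ge0 => w _; rewrite lee_fin mulr_ge0. Qed.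

Lemma tilted_mean0 h : tilted_mean 0 h = (h 0)%:E.
Proof.
rewrite /tilted_mean; under eq_integral do rewrite tilt0 walk_time0 mul1r.
by rewrite integral_cst//= probability_setT mule1.
Qed.

Lemma tilted_mean_indep n (h : R -> R) (g : R * R -> R) :
  measurable_fun setT h -> measurable_fun setT g ->
  (forall x, 0 <= h x) -> (forall y, 0 <= g y) ->
  (tilted_mean n h * \int[P0]_v (tilt l e (tau v, X v) * g (tau v, X v))%:E =
   \int[P]_w (tilt l e (walk_state n w) * h (walk_time n w) *
     (tilt l e (tau_ n w, X_ n w) * g (tau_ n w, X_ n w)))%:E)%E.
Proof.
move=> mh mg h0 g0; rewrite (@walk_integral_prod n
  (fun z => tilt l e z * h z.1) (fun y => tilt l e y * g y))//.
- by apply: measurable_funM => //; exact: measurableT_comp.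
- exact: measurable_funM.
- by move=> z; rewrite mulr_ge0.
- by move=> z; rewrite mulr_ge0.
Qed.

Lemma tilted_mean_indep1 n (h : R -> R) :
  measurable_fun setT h -> (forall x, 0 <= h x) ->
  (tilted_mean n h = \int[P]_w
    (tilt l e (walk_state n w) * h (walk_time n w) * tilt l e (tau_ n w, X_ n w))%:E)%E.
Proof.
move=> mh h0.
have := @tilted_mean_indep n h (fun=> 1) mh (measurable_cst _) h0 (fun=> ler01).
under eq_integral do rewrite mulr1.
rewrite -/(laplace tau X l e) root1 mule1 => ->.
by apply: eq_integral => w _; rewrite mulr1.
Qed.

(** * Potential bounds *)

Variable delta : R.
Hypothesis delta_gt0 : 0 < delta.
Hypothesis deltaP : (delta%:E <= \int[P0]_v
  (expR (l * X v - e * tau v) * Num.min `|tau v| 1)%:E)%E.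

(** Averaged over one step of the tilted walk, [phi] loses at least [delta] at
    each visit to the window [b] and gains nothing elsewhere; as it stays
    nonnegative, its initial value pays for all the visits. *)
Lemma renewal_potential (b : R -> bool) (phi : R -> R) N :
  measurable_fun setT b -> measurable_fun setT phi -> (forall x, 0 <= phi x) ->
  (forall x s, 0 < s -> (b x)%:R * Num.min s 1 + phi (x + s) <= phi x) ->
  (delta%:E * (\sum_(n < N) tilted_mean n (fun x => (b x)%:R)) +
   tilted_mean N phi <= (phi 0)%:E)%E.
Proof.
move=> mb mphi phi0 super.
have mbR : measurable_fun setT (fun x => (b x)%:R : R).
  exact: measurable_bool_nat.
have b0 x : 0 <= (b x)%:R :> R by [].
have mean_step n : (delta%:E * tilted_mean n (fun x => (b x)%:R) +
    tilted_mean n.+1 phi <= tilted_mean n phi)%E.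
  have mmin : measurable_fun setT (fun y : R * R => Num.min `|y.1| 1).
    by apply: measurable_minr => //; exact: measurableT_comp.
  have min0 (y : R * R) : 0 <= Num.min `|y.1| 1 by rewrite le_min normr_ge0 ler01.
  rewrite (tilted_mean_indep1 n mphi phi0).
  apply: (@le_trans _ _ (tilted_mean n (fun x => (b x)%:R) *
    (\int[P0]_v (tilt l e (tau v, X v) * Num.min `|(tau v, X v).1| 1)%:E) +
    tilted_mean n.+1 phi)%E).
    by rewrite leeD2r// muleC lee_wpmul2l// tilted_mean_ge0.
  rewrite (tilted_mean_indep n mbR mmin b0 min0) /tilted_mean.
  have mmin_step : measurable_fun setT (fun w => Num.min `|tau_ n w| 1).
    by apply: measurable_minr => //; exact: measurableT_comp.
  have mbw := mtime n mbR.
  have mphiw := mtime n mphi.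
  have mphiw1 := mtime n.+1 mphi.
  have min0w w : 0 <= Num.min `|tau_ n w| 1 by rewrite le_min normr_ge0 ler01.
  rewrite -integralD_real//.
  - apply: ae_le_integral => //.
    + by apply: measurable_funD; repeat apply: measurable_funM.
    + by repeat apply: measurable_funM.
    + by move=> w; rewrite addr_ge0// !mulr_ge0.
    + by move=> w; rewrite !mulr_ge0.
    apply: filterS (walk_step_gt0 n) => w tw.
    rewrite tiltS walk_timeS /= (gtr0_norm tw).
    have := super (walk_time n w) _ tw.
    set m := tilt l e _; set s := tilt l e _ => h.
    have -> : m * (b (walk_time n w))%:R * (s * Num.min (tau_ n w) 1) +
      m * s * phi (walk_time n w + tau_ n w) = m * s * 
      ((b (walk_time n w))%:R * Num.min (tau_ n w) 1 + phi (walk_time n w + tau_ n w)).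
      by ring.
    have ms0 : 0 <= m * s by rewrite mulr_ge0 ?tilt_ge0.
    by rewrite [leRHS]mulrAC ler_wpM2l.
  - by repeat apply: measurable_funM.
  - by repeat apply: measurable_funM.
  - by move=> w; rewrite !mulr_ge0.
  - by move=> w; rewrite !mulr_ge0.
elim: N => [|N IH]; first by rewrite big_ord0 mule0 add0e tilted_mean0.
rewrite big_ord_recr/= ge0_muleDr//; last 2 first.
- by apply: sume_ge0 => n _; exact: tilted_mean_ge0.
- exact: tilted_mean_ge0.
by apply: le_trans IH; rewrite -addeA leeD2l.
Qed.

Variable t : R.
Hypothesis t_ge0 : 0 <= t.

(** The Lyapunov function is the distance to [t + 1], truncated to the interval
    from [0] to the length of the window plus one.  The margin of [1] beyond [t]
    is what a step cut at [1] may need to make its full progress. *)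
Lemma window_potential s N :
  (delta%:E * (\sum_(n < N)
    tilted_mean n (fun x => (t - s < x <= t)%R%:R)) <= (1 + `|s|)%:E)%E.
Proof.
pose phi x := Num.max 0 (Num.min (t + 1 - x) (1 + `|s|)).
have phi0 x : 0 <= phi x by rewrite le_max lexx.
have mb : measurable_fun setT (fun x : R => (t - s < x <= t)%R).
  by apply: measurable_and; [exact: measurable_fun_ltr|exact: measurable_fun_ler].
have mphi : measurable_fun setT phi.
  apply: measurable_maxr => //; apply: measurable_minr => //.
  exact: measurable_funB.
have super x r : 0 < r ->
    (t - s < x <= t)%R%:R * Num.min r 1 + phi (x + r) <= phi x.
  move=> r0; have s0 := normr_ge0 s; have := ler_norm s; rewrite /phi.
  have [/andP[] x1 x2 /=|_] := boolP (t - s < x <= t)%R;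
  rewrite ?mul1r ?mul0r ?add0r !maxEle !minEle;
  by do ! case: ifP => //; lra.
have := renewal_potential N mb mphi phi0 super.
have phi0_le : ((phi 0)%:E <= (1 + `|s|)%:E)%E.
  by rewrite lee_fin /phi ge_max addr_ge0//= ge_min lexx orbT.
move=> /le_trans /(_ phi0_le); apply: le_trans.
by rewrite leeDl// tilted_mean_ge0.
Qed.

(** Finite for each [t], though not uniformly: it serves only to show that the
    tilted walk eventually leaves the past of [t]. *)
Lemma past_potential N :
  (delta%:E * (\sum_(n < N) tilted_mean n (fun x => (x <= t)%R%:R))
   <= (t + 1)%:E)%E.
Proof.
pose phi x := Num.max 0 (t + 1 - x).
have phi0 x : 0 <= phi x by rewrite le_max lexx.
have mb : measurable_fun setT (fun x : R => (x <= t)%R).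
  exact: measurable_fun_ler.
have mphi : measurable_fun setT phi.
  by apply: measurable_maxr => //; exact: measurable_funB.
have super x r : 0 < r ->
    (x <= t)%R%:R * Num.min r 1 + phi (x + r) <= phi x.
  move=> r0; rewrite /phi.
  have [x1|x1] := leP x t; rewrite /= ?mul1r ?mul0r ?add0r !maxEle ?minEle;
  by do ! case: ifP => //; lra.
have := renewal_potential N mb mphi phi0 super.
have -> : phi 0 = t + 1 by rewrite /phi subr0; apply/max_idPr; rewrite addr_ge0.
by apply: le_trans; rewrite leeDl// tilted_mean_ge0.
Qed.

(** * The step that crosses a level *)

Definition crossing n w : R := (walk_time n w <= t < walk_time n w + tau_ n w)%R%:R.

Let mcrossing n : measurable_fun setT (crossing n).
Proof.
apply: measurable_bool_nat; apply: measurable_and.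
  exact: measurable_fun_ler.
by apply: measurable_fun_ltr => //; exact: measurable_funD.
Qed.

(** A step of given length [s] crosses [t] exactly when it starts in the window
    of length [s] that ends at [t]; summing over [n] first, for a fixed step,
    brings in [window_potential]. *)
Lemma crossing_upper (g : R * R -> R) N :
  measurable_fun setT g -> (forall y, 0 <= g y) ->
  (delta%:E * (\sum_(n < N) \int[P]_w
     (tilt l e (walk_state n w) * g (tau_ n w, X_ n w) * crossing n w)%:E) <=
   \int[P0]_v ((1 + `|tau v|) * g (tau v, X v))%:E)%E.
Proof.
move=> mg g0.
pose F (p : (R * R) * (R * R)) := (tilt l e p.1 * g p.2 *
  (p.1.1 <= t < p.1.1 + p.2.1)%R%:R)%:E.
have m11 : measurable_fun setT (fun p : (R * R) * (R * R) => p.1.1).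
  exact: measurableT_comp.
have m21 : measurable_fun setT (fun p : (R * R) * (R * R) => p.2.1).
  exact: measurableT_comp.
have mF : measurable_fun setT F.
  apply/measurable_EFinP; apply: measurable_funM.
    by apply: measurable_funM; exact: measurableT_comp.
  apply: measurable_bool_nat; apply: measurable_and.
    exact: measurable_fun_ler.
  by apply: measurable_fun_ltr => //; exact: measurable_funD.
have F0 p : (0 <= F p)%E by rewrite lee_fin !mulr_ge0.
pose G n v := (\int[P]_w F (walk_state n w, (tau v, X v)))%E.
have mG n : measurable_fun setT (G n) by exact: measurable_walk_integral.
have G0 n v : (0 <= G n v)%E by exact: integral_ge0.
have -> : (\sum_(n < N) \int[P]_w
    (tilt l e (walk_state n w) * g (tau_ n w, X_ n w) * crossing n w)%:E =
    \int[P0]_v (\sum_(n < N) G n v))%E.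
  rewrite ge0_integral_sum//; apply: eq_bigr => n _.
  exact: (walk_integral n mF F0).
have mgY : measurable_fun setT (fun v => g (tau v, X v)).
  by apply: measurableT_comp => //; exact: measurable_fun_pair.
have mtau1 : measurable_fun setT (fun v => 1 + `|tau v|).
  by apply: measurable_funD => //; exact: measurableT_comp.
have msum : measurable_fun setT (fun v => (\sum_(n < N) G n v)%E).
  exact: emeasurable_sum.
have sum0 v : (0 <= \sum_(n < N) G n v)%E by exact: sume_ge0.
rewrite -ge0_integralZl_EFin ?(ltW delta_gt0)//.
apply: ge0_le_integral => //.
- by move=> v _; rewrite mule_ge0// lee_fin ltW.
- exact: measurable_funeM.
- by apply/measurable_EFinP; exact: measurable_funM.
move=> v _.
have -> : (\sum_(n < N) G n v = (g (tau v, X v))%:E *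
    \sum_(n < N) tilted_mean n (fun x => (t - tau v < x <= t)%R%:R))%E.
  rewrite ge0_sume_distrr; last by move=> n _; exact: tilted_mean_ge0.
  apply: eq_bigr => n _; rewrite /G /F /tilted_mean -integralZ_real//.
  - apply: eq_integral => w _; congr EFin.
    by rewrite /= mulrAC mulrC ltrBlDr andbC.
  - apply: measurable_funM => //.
    apply: (@mtime (fun x => (t - tau v < x <= t)%R%:R) n).
    apply: measurable_bool_nat.
    by apply: measurable_and; [exact: measurable_fun_ltr|
      exact: measurable_fun_ler].
  - by move=> w; rewrite mulr_ge0.
rewrite muleCA mulrC EFinM lee_wpmul2l ?lee_fin//.
exact: window_potential.
Qed.

(** From a position before [t], the next step either stays before [t] or crosses
    it. *)
Lemma crossing_step n :
  (\int[P]_w (tilt l e (walk_state n w) * tilt l e (tau_ n w, X_ n w) *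
     crossing n w)%:E + tilted_mean n.+1 (fun x => (x <= t)%R%:R) =
   tilted_mean n (fun x => (x <= t)%R%:R))%E.
Proof.
have mle : measurable_fun setT (fun x : R => (x <= t)%R%:R : R).
  by apply: measurable_bool_nat; exact: measurable_fun_ler.
have mlew k := mtime k mle.
rewrite (tilted_mean_indep1 n mle)// /tilted_mean -integralD_real//; last 4 first.
- by repeat apply: measurable_funM.
- exact: measurable_funM.
- by move=> w; rewrite !mulr_ge0.
- by move=> w; rewrite !mulr_ge0.
apply: ae_eq_integral_real => //.
- by apply: measurable_funD; repeat apply: measurable_funM.
- by repeat apply: measurable_funM.
- by move=> w; rewrite addr_ge0// !mulr_ge0.
- by move=> w; rewrite !mulr_ge0.
apply: filterS (walk_step_gt0 n) => w tw.
rewrite tiltS walk_timeS -mulrDr [RHS]mulrAC; congr (_ * _).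
rewrite /crossing ltNge -natrD; congr (_%:R).
have [h1|h1] := leP (walk_time n w + tau_ n w) t; last by rewrite andbT addn0.
by rewrite andbF add0n (le_trans _ h1)// lerDl ltW.
Qed.

(** The probabilities of being still below [t] decrease in [n] and have a finite
    sum by [past_potential], so they fall below one half; the telescoping sum of
    [crossing_step] leaves the other half to the crossings. *)
Lemma crossing_lower : exists N, ((2^-1)%:E <= \sum_(n < N) \int[P]_w
  (tilt l e (walk_state n w) * tilt l e (tau_ n w, X_ n w) * crossing n w)%:E)%E.
Proof.
pose a n := tilted_mean n (fun x => (x <= t)%R%:R).
pose p n := (\int[P]_w (tilt l e (walk_state n w) * tilt l e (tau_ n w, X_ n w) *
  crossing n w)%:E)%E.
have a_ge0 n : (0 <= a n)%E by exact: tilted_mean_ge0.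
have p_ge0 n : (0 <= p n)%E.
  by apply: integral_ge0 => w _; rewrite lee_fin !mulr_ge0.
have telescope N : (\sum_(n < N) p n + a N = 1)%E.
  elim: N => [|N IH]; first by rewrite big_ord0 add0e /a tilted_mean0 t_ge0.
  by rewrite big_ord_recr/= -addeA crossing_step.
have a_anti n m : (n <= m)%N -> (a m <= a n)%E.
  move/subnK <-; elim: (m - n)%N => // k; apply: le_trans.
  rewrite addSn -[leRHS](crossing_step (k + n)) leeDr//; exact: p_ge0.
(* [N] times the [N]-th probability is at most [(t + 1) / delta] *)
pose N := (Num.trunc (2 * (t + 1) / delta)).+1.
have hN : 2 * (t + 1) / delta < N%:R by exact: truncnS_gt.
have aNfin : a N \is a fin_num.
  rewrite ge0_fin_numE// (@le_lt_trans _ _ 1%E) ?ltry//.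
  by rewrite -[leRHS](telescope N) leeDr// sume_ge0.
have aN : (a N <= (2^-1)%:E)%E.
  have : (delta%:E * (N%:R%:E * a N) <= (t + 1)%:E)%E.
    apply: le_trans (past_potential N); rewrite lee_wpmul2l ?lee_fin ?(ltW delta_gt0)//.
    have -> : (N%:R%:E * a N = \sum_(n < N) a N)%E.
      rewrite -(fineK aNfin) sumEFin sumr_const card_ord -EFinM.
      by rewrite mulr_natl.
    by apply: lee_sum => n _; apply: a_anti; rewrite ltnW.
  rewrite -(fineK aNfin) -!EFinM !lee_fin => h.
  rewrite ltr_pdivrMr// in hN.
  have /ltW a0 := hN; rewrite leNgt; apply/negP => h2.
  have : 2^-1 * (N%:R * delta) < fine (a N) * (N%:R * delta).
    by rewrite ltr_pM2r// mulr_gt0// ltr0n.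
  lra.
exists N; rewrite -/(p _).
have := telescope N; set s := (\sum_(n < N) p n)%E => sa.
rewrite leNgt; apply/negP => sl.
have : (s + a N < (2^-1)%:E + (2^-1)%:E)%E by rewrite lte_leD.
have -> : ((2^-1)%:E + (2^-1)%:E = 1 :> \bar R)%E by rewrite -EFinD; congr EFin; lra.
by rewrite sa ltxx.
Qed.

(** * Two-sided bounds for the renewal-reward functional *)

Hypothesis e_ge0 : 0 <= e.

Definition crossing_value n w : R := expR (l * walk_reward n w - e * t) * crossing n w.

Let mvalue n : measurable_fun setT (crossing_value n).
Proof.
apply: measurable_funM => //; apply: measurableT_comp => //.
apply: measurable_funB => //; exact: measurable_funM.
Qed.

Let value_ge0 n w : 0 <= crossing_value n w.
Proof. by rewrite mulr_ge0 ?expR_ge0. Qed.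

(** At a crossing [T_n <= t], so replacing [T_n] by [t] in the tilt lowers it. *)
Lemma crossing_value_upper N :
  (delta%:E * (\sum_(n < N) \int[P]_w (crossing_value n w)%:E) <=
  \int[P0]_v (1 + `|tau v|)%:E)%E.
Proof.
have := @crossing_upper (fun=> 1) N (measurable_cst _) (fun=> ler01).
under [in X in (_ <= X)%E -> _]eq_integral do rewrite mulr1.
apply: le_trans; rewrite lee_wpmul2l ?lee_fin ?(ltW delta_gt0)//.
apply: lee_sum => n _; apply: ae_le_integral => //.
- by apply: measurable_funM => //; exact: measurable_funM.
- by move=> w; rewrite !mulr_ge0.
apply: aeW => w; rewrite mulr1 /crossing_value /crossing.
have [/andP[Tt _]|_] := boolP (_ <= _ < _)%R; last by rewrite !mulr0.
by rewrite ler_wpM2r// ler_expR lerD2l lerN2 ler_wpM2l.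
Qed.

(** Each crossing step is good if [exp (l X) <= k] and bad otherwise.  A good
    step has one-step tilt at most [k exp (- e (t - T_n))], as it is longer than
    [t - T_n]; on a bad one, [exp (l X) <= exp (2 l X) / k]. *)
Lemma crossing_value_lower (B : R) :
  (\int[P0]_v ((1 + `|tau v|) * expR ((2 * l) * X v - e * tau v))%:E <=
     B%:E)%E ->
  exists N, ((delta / (16 * (`|B| + 1)))%:E <=
    \sum_(n < N) \int[P]_w (crossing_value n w)%:E)%E.
Proof.
move=> hB.
pose g y : R := expR ((2 * l) * y.2 - e * y.1).
have mg : measurable_fun setT g.
  apply: measurableT_comp => //.
  by apply: measurable_funB; apply: measurable_funM.
have g0 y : 0 <= g y by exact: expR_ge0.
have [N hN] := crossing_lower.
have := @crossing_upper g N mg g0.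
move=> /le_trans /(_ hB); set bad := (\sum_(n < N) _)%E => hbad.
exists N; set V := (\sum_(n < N) _)%E.
have B1 : 0 < `|B| + 1 by rewrite ltr_wpDl.
(* makes the bad steps weigh at most one quarter *)
pose k := 4 * (`|B| + 1) / delta.
have k0 : 0 < k by rewrite divr_gt0// mulr_gt0.
have mgw n : measurable_fun setT
    (fun w => tilt l e (walk_state n w) * g (tau_ n w, X_ n w) * crossing n w).
  apply: measurable_funM => //; apply: measurable_funM => //.
  by apply: measurableT_comp => //; exact: measurable_fun_pair.
have bad0 : (0 <= bad)%E.
  by apply: sume_ge0 => n _; apply: integral_ge0 => w _; rewrite lee_fin !mulr_ge0.
have V0 : (0 <= V)%E.
  by apply: sume_ge0 => n _; apply: integral_ge0 => w _; rewrite lee_fin.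
have split_bad : ((2^-1)%:E <= k%:E * V + k^-1%:E * bad)%E.
  apply: (le_trans hN); rewrite /V /bad.
  rewrite !ge0_sume_distrr; last 2 first.
  - by move=> n _; apply: integral_ge0 => w _; rewrite lee_fin !mulr_ge0.
  - by move=> n _; apply: integral_ge0 => w _; rewrite lee_fin.
  rewrite -big_split/=; apply: lee_sum => n _.
  rewrite -!integralZ_real ?invr_ge0 ?(ltW k0)//; last first.
    by move=> w; rewrite !mulr_ge0.
  rewrite -integralD_real//; last 4 first.
  - exact: measurable_funM.
  - exact: measurable_funM.
  - by move=> w; rewrite mulr_ge0// ltW.
  - by move=> w; rewrite !mulr_ge0// invr_ge0 ltW.
  apply: ae_le_integral => //.
  - by apply: measurable_funM => //; exact: measurable_funM.
  - by apply: measurable_funD; exact: measurable_funM.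
  - by move=> w; rewrite !mulr_ge0.
  - move=> w; rewrite addr_ge0// mulr_ge0 ?invr_ge0 ?(ltW k0)//.
    by rewrite !mulr_ge0.
  apply: aeW => w; rewrite /crossing_value /crossing.
  have [/andP[Tt tT]|_] := boolP (_ <= _ < _)%R; last by rewrite !mulr0 addr0.
  rewrite !mulr1 /tilt /walk_state /g /=.
  set S := walk_reward n w; set s := walk_time n w; set x := X_ n w; set r := tau_ n w.
  have [small|large] := lerP (expR (l * x)) k.
    rewrite ler_wpDr ?mulr_ge0 ?invr_ge0 ?expR_ge0 ?(ltW k0)//.
    rewrite -expRD (_ : l * S - e * s + (l * x - e * r) =
      l * x + (l * S - e * (s + r))); last by ring.
    rewrite expRD ler_pM ?expR_ge0// ler_expR lerD2l lerN2 ler_wpM2l//.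
    exact: ltW.
  apply: ler_wpDl; first by rewrite mulr_ge0 ?expR_ge0 ?(ltW k0).
  rewrite mulrCA ler_wpM2l ?expR_ge0//.
  rewrite (_ : 2 * l * x - e * r = l * x + (l * x - e * r)); last by ring.
  rewrite [expR (l * x + (_ - _))]expRD mulrA ler_peMl ?expR_ge0//.
  by rewrite ler_pdivlMl// mulr1 ltW.
have [->|Vfin] := eqVneq V +oo%E; first by rewrite leey.
have /fineK VE : V \is a fin_num by rewrite ge0_fin_numE// ltey.
have /fineK badE : bad \is a fin_num.
  rewrite ge0_fin_numE// ltey; apply/eqP => badoo; move: hbad.
  by rewrite badoo gt0_muley ?lte_fin// leye_eq.
move: split_bad hbad; rewrite -VE -badE -!EFinM -EFinD !lee_fin.
set v := fine V; set u := fine bad => h1 h2.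
have BB := ler_norm B.
have hu : k^-1 * u <= 4^-1.
  rewrite ler_pdivrMl//  /k mulrC mulrA ler_pdivlMr// (le_trans _ (_ : `|B| + 1 <= _))//.
    by rewrite mulrC; lra.
  by lra.
have hkv : 4^-1 <= k * v by lra.
rewrite ler_pdivrMr ?mulr_gt0//.
have kE : delta * (k * v) = 4 * (`|B| + 1) * v.
  by rewrite /k; field; rewrite gt_eqF.
have := ler_wpM2l (ltW delta_gt0) hkv; rewrite kE; lra.
Qed.

Local Notation reward := (renewal_reward (fun i => tau_ i : T -> R)
  (fun i => X_ i : T -> R) t).
Local Notation index := (renewal_index (fun i => tau_ i : T -> R) t).

Let crossingE n w : crossing n w = (index w n)%:R.
Proof. by rewrite /crossing /renewal_index -walk_timeS. Qed.

(** The least renewal index splits the space into countably many measurable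
    pieces, on each of which the reward is a partial sum. *)
Lemma measurable_renewal_reward : measurable_fun setT reward.
Proof.
pose I n := [set w | index w n].
have mI n : measurable (I n).
  have mb : measurable_fun setT (fun w => index w n).
    apply: measurable_and.
      exact: measurable_fun_ler.
    exact: measurable_fun_ltr.
  rewrite (_ : I n = (fun w => index w n) @^-1` [set true]).
    by rewrite -[_ @^-1` _]setTI; exact: mb.
  by apply/seteqP; split => w.
have mUI : measurable (\bigcup_n I n) by exact: bigcup_measurable.
have -> : setT = \bigcup_n I n `|` ~` \bigcup_n I n by rewrite setUv.
apply/measurable_funU => //; first exact: measurableC.
split; last first.
  apply: (eq_measurable_fun (fun=> 0 : R)) => //.
  move=> w; rewrite inE => noI; rewrite /renewal_reward.
  by case: pselect => // -[n hn]; exfalso; apply: noI; exists n.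
rewrite seqDU_bigcup_eq; apply/measurable_fun_bigcup => [n|n].
  by apply: measurableD => //; exact: bigsetU_measurable.
apply: (eq_measurable_fun (walk_reward n)); last first.
  exact: measurable_funTS.
move=> w; rewrite inE => -[In notbefore].
rewrite /renewal_reward; case: pselect => [h|]; last by case; exists n.
case: ex_minnP => m hm mmin; have mn := mmin n In.
have [//|nm] := eqVneq m n; first by move=> ->.
exfalso; apply: notbefore; rewrite -bigcup_mkord; exists m => //=.
by rewrite ltn_neqAle nm.
Qed.

Definition renewal_value w : R := expR (l * reward w - e * t).

Let mrenewal_value : measurable_fun setT renewal_value.
Proof.
apply: measurableT_comp => //; apply: measurable_funB => //.
by apply: measurable_funM => //; exact: measurable_renewal_reward.
Qed.

Let renewal_value_ge0 w : 0 <= renewal_value w. Proof. exact: expR_ge0. Qed.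

(** The extra [1] pays for the trajectories that never cross [t]: there the
    reward is [0] by convention, and [exp (- e t) <= 1]. *)
Lemma renewal_value_upper : (\int[P]_w (renewal_value w)%:E <=
  1 + (delta^-1)%:E * \int[P0]_v (1 + `|tau v|)%:E)%E.
Proof.
have mval n : measurable_fun setT (fun w => (crossing_value n w)%:E).
  exact/measurable_EFinP.
have val0 n w : (0 <= (crossing_value n w)%:E)%E by rewrite lee_fin.
apply: (@le_trans _ _ (1 + \sum_(0 <= n <oo) \int[P]_w (crossing_value n w)%:E)%E).
  rewrite -integral_nneseries//.
  have <- : (\int[P]_w (1%:E) = 1)%E.
    by rewrite integral_cst//= probability_setT mule1.
  have mser : measurable_fun setT (fun w => \sum_(0 <= n <oo) (crossing_value n w)%:E)%E.
    exact: ge0_emeasurable_sum.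
  have ser0 w : (0 <= \sum_(0 <= n <oo) (crossing_value n w)%:E)%E.
    exact: nneseries_ge0.
  rewrite -ge0_integralD//; apply: ge0_le_integral => //.
  - by move=> w _; rewrite lee_fin.
  - exact/measurable_EFinP.
  - exact: emeasurable_funD.
  move=> w _; rewrite /renewal_value /renewal_reward.
  case: pselect => [h|_]; last first.
    rewrite mulr0 sub0r (@le_trans _ _ 1%E) ?leeDl//.
    by rewrite lee_fin -expR0 ler_expR oppr_le0 mulr_ge0.
  case: ex_minnP => n hn _; apply: (@le_trans _ _ (crossing_value n w)%:E).
    by rewrite /crossing_value crossingE hn mulr1.
  rewrite -[leLHS]add0e leeD//.
  apply: le_trans (nneseries_lim_ge n.+1 _) => //.
  rewrite big_nat_recr//= leeDr//.
  by apply: sume_ge0 => i *.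
rewrite leeD2l//; apply: lime_le.
  by apply: is_cvg_nneseries => n _ _; exact: integral_ge0.
apply: nearW => N; rewrite big_mkord.
by rewrite lee_pdivlMl//; exact: crossing_value_upper.
Qed.

(** When all steps are positive, at most one of them crosses [t], and the reward
    is then the partial sum up to that step. *)
Lemma renewal_value_lower N :
  (\sum_(n < N) \int[P]_w (crossing_value n w)%:E <= \int[P]_w (renewal_value w)%:E)%E.
Proof.
rewrite -ge0_integral_sum//; last 2 first.
- by move=> n; exact/measurable_EFinP.
- by move=> n w _; rewrite lee_fin.
under eq_integral do rewrite sumEFin.
apply: ae_le_integral => //.
- exact: measurable_sum.
- by move=> w; exact: sumr_ge0.
apply: filterS (ae_foralln (walk_step_gt0)) => w tw.
have valueE n : crossing_value n w = renewal_value w * crossing n w.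
  rewrite crossingE /crossing_value crossingE.
  have [hn|_] := boolP (index w n); last by rewrite !mulr0.
  by rewrite !mulr1 /renewal_value (renewal_rewardE _ tw hn).
under eq_bigr do rewrite valueE.
rewrite -mulr_sumr ler_piMr//.
have : \sum_(n < N) crossing n w + (walk_time N w <= t)%R%:R <= 1.
  elim: N => [|N IH]; first by rewrite big_ord0 add0r lern1 leq_b1.
  apply: le_trans IH; rewrite big_ord_recr/= -addrA lerD2l /crossing walk_timeS.
  rewrite -natrD ler_nat; have [Tt|tT] := leP (walk_time N w) t.
    by rewrite leNgt; case: (_ < _)%R.
  by rewrite leNgt (lt_trans tT) ?ltrDl.
by apply: le_trans; rewrite lerDl.
Qed.

End renewal_walk.

(** * The growth rate *)

Lemma log_growth_rate (R : realType) (V : \bar R) (a b e t : R) :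
  0 < a -> 0 < t -> (a%:E <= V <= b%:E)%E ->
  (`| (t^-1)%:E * lne ((expR (e * t))%:E * V) - e%:E | <=
    ((`|ln a| + `|ln b| + 1) / t)%:E)%E.
Proof.
move=> a0 t0; case: V => [v||] /andP[]; rewrite ?leye_eq// ?lee_fin => av vb.
have v0 := lt_le_trans a0 av; have b0 := lt_le_trans v0 vb.
rewrite -EFinM lne_EFin ?mulr_gt0 ?expR_gt0// lnM ?posrE ?expR_gt0// expRK.
rewrite -EFinM -EFinB abse_EFin lee_fin.
have -> : t^-1 * (e * t + ln v) - e = ln v / t.
  by field; rewrite gt_eqF.
rewrite normrM normfV (gtr0_norm t0) ler_wpM2r ?invr_ge0 ?(ltW t0)//.
have lav : ln a <= ln v by rewrite ler_ln ?posrE.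
have lvb : ln v <= ln b by rewrite ler_ln ?posrE.
have := ler_norm (ln b); have := ler_norm (- ln a); rewrite normrN.
have := normr_ge0 (ln a); have := normr_ge0 (ln b).
by case: (ger0P (ln v)) => _; lra.
Qed.

Theorem theorem2 (R : realType)
    (d0 d : measure_display)
    (Omega0 : measurableType d0) (Omega : measurableType d)
    (P0 : probability Omega0 R) (P : probability Omega R)
    (tau X : {RV P0 >-> R})
    (tau_ X_ : nat -> {RV P >-> R})
    (copies : forall i : nat,
       same_distribution P P0 (fun w => (tau_ i w, X_ i w))
                              (fun w => (tau w, X w)))
    (indep : mutually_independent P
       (fun (i : nat) (w : Omega) => (tau_ i w, X_ i w)))
    (tau_gt0 : {ae P0, forall w, 0 < tau w})
    (Etau : ('E_P0[tau] < +oo)%E)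
    (Eexp : forall lambda eps : R, 0 < eps ->
       ('E_P0[fun w => expR (lambda * X w - eps * tau w)] < +oo)%E)
    (EX : ('E_P0[X] = 0)%E) :
  (forall lambda : R, exists! eta : R,
     0 <= eta /\
     ('E_P0[fun w => expR (lambda * X w - eta * tau w)] = 1)%E)
  /\
  (forall eta : R -> R,
     (forall lambda : R,
        0 <= eta lambda /\
        ('E_P0[fun w => expR (lambda * X w - eta lambda * tau w)] = 1)%E) ->
     forall c C : R, 0 < c -> c < C ->
     exists T K : R, 0 < T /\ 0 < K /\
       forall t lambda : R, T <= t ->
         (lambda \in `[- C, - c] \/ lambda \in `[c, C]) ->
         (`| (t^-1)%:E *
             lne 'E_P[fun w => expR (lambda *
                        renewal_reward (fun i => tau_ i : Omega -> R)
                                       (fun i => X_ i : Omega -> R) t w)]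
             - (eta lambda)%:E | <= (K / t)%:E)%E).
Proof.
rewrite unlock in Etau; rewrite unlock in EX.
have Eexp' l e : 0 < e -> (laplace tau X l e < +oo)%E.
  by move=> e0; have := Eexp l e e0; rewrite unlock.
have laplaceE l e : ('E_P0[fun w => expR (l * X w - e * tau w)])%E =
    laplace tau X l e by rewrite unlock.
split.
  move=> l; have [e e0 le1] := laplace_root tau_gt0 Etau Eexp' EX l.
  exists e; split; first by rewrite laplaceE.
  by move=> y [_]; rewrite laplaceE => ly1; exact: (laplace_inj tau_gt0 le1 ly1).
move=> eta eta_root c C c0 cC.
have eta_ge0 l : 0 <= eta l by have [] := eta_root l.
have etaP l : laplace tau X l (eta l) = 1%E.
  by have [_] := eta_root l; rewrite laplaceE.
have [delta delta0 deltaP] :=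
  drift_lower_bound tau_gt0 eta_ge0 etaP c0 (ltW cC).
have [B BP] :=
  tilted_overshoot_bound tau_gt0 Etau Eexp' EX eta_ge0 etaP c0 (ltW cC).
pose a := delta / (16 * (`|B| + 1)).
have a0 : 0 < a by rewrite divr_gt0// mulr_gt0// ltr_wpDl.
pose b := 1 + delta^-1 * fine (\int[P0]_v (1 + `|tau v|)%:E).
have bE : (1 + (delta^-1)%:E * \int[P0]_v (1 + `|tau v|)%:E = b%:E)%E.
  rewrite /b EFinD EFinM fineK// ge0_fin_numE; last first.
    by apply: integral_ge0 => w _; rewrite lee_fin addr_ge0.
  rewrite integralD_real//; last exact: measurableT_comp.
  rewrite integral_cst//= probability_setT mule1.
  by apply: lte_add_pinfty; [exact: ltry|exact: norm_tau_lty].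
exists 1, (`|ln a| + `|ln b| + 1); split => //; split.
  by rewrite ltr_wpDl ?addr_ge0.
move=> t l t1 lrange.
have t0 : 0 < t by exact: lt_le_trans t1.
have cl : c <= `|l| <= C.
  case: lrange; rewrite in_itv/= => /andP[l1 l2].
  - have l0 : l < 0 by lra.
    by rewrite ltr0_norm//; apply/andP; split; lra.
  - have l0 : 0 < l by lra.
    by rewrite gtr0_norm// l1.
rewrite unlock; set S := renewal_reward _ _ t.
have mS : measurable_fun setT S by exact: measurable_renewal_reward.
have -> : (\int[P]_w (expR (l * S w))%:E = (expR (eta l * t))%:E *
    \int[P]_w (expR (l * S w - eta l * t))%:E)%E.
  rewrite -integralZ_real//; last first.
  - apply: measurableT_comp => //; apply: measurable_funB => //.
    exact: measurable_funM.
  - by apply: eq_integral => w _; rewrite -expRD addrC subrK.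
apply: log_growth_rate => //; apply/andP; split.
  have [N aN] := crossing_value_lower copies indep tau_gt0 (etaP l) delta0
    (deltaP _ cl) (ltW t0) (eta_ge0 l) (BP _ cl).
  by apply: (le_trans aN); exact: (renewal_value_lower copies tau_gt0).
by rewrite -bE; exact: (renewal_value_upper copies indep tau_gt0 (etaP l) delta0
  (deltaP _ cl) (ltW t0) (eta_ge0 l)).
Qed.
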